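(* (i) Let $q\geq 3$ be an odd number and let $U$ be a subset of the vertices of the Hamming graph $H(2,q)$ with $|U|\geq 2q$. Then the VC-dimension of $(U,n(U))$ is at least $2$. (ii) This bound is tight: for every odd $q\ge 3$ there is a subset $U$ of the vertices of $H(2,q)$ with $|U|=2q-1$ such that the VC-dimension of $(U,n(U))$ is less than $2$. (iii) The bound $|U|\ge 2q+1$, which guarantees that the VC-dimension of $(U,n(U))$ is at least $2$ for all $q\ge 3$ (odd or even) and $U\subseteq H(2,q)$, is tight in general: for every even $q\ge 4$ there is a subset $U$ of the vertices of $H(2,q)$ with $|U|=2q$ such that the VC-dimension of $(U,n(U))$ is less than $2$.
   Context: The Hamming graph $H(2,q)$ has vertex set $\mathbb Z_q^2$, with two vertices adjacent if and only if they differ in exactly one coordinate. For a vertex $x$, $n(x)$ denotes its neighborhood, the set of vertices adjacent to $x$ (so $x\notin n(x)$), and for a set $U$ of vertices $n(U)=\{n(u):u\in U\}$. A set $W\subseteq U$ is shattered by $n(U)$ if for every $S\subseteq W$ there is $u\in U$ with $n(u)\cap W=S$. The VC-dimension of $(U,n(U))$ is the size of the largest $W\subseteq U$ that is shattered by $n(U)$. *)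

(* Defs.v *)
From mathcomp Require Import all_boot all_algebra.

Set Implicit Arguments.
Unset Strict Implicit.
Unset Printing Implicit Defensive.

Section VCDimension.

Variable T : finType.

Definition shattered (F : {set {set T}}) (W : {set T}) : bool :=
  [forall S : {set T}, (S \subset W) ==> [exists N in F, N :&: W == S]].

(* When F is empty no set is shattered, not even set0, and the value is 0. *)
Definition vc_dim (U : {set T}) (F : {set {set T}}) : nat :=
  \max_(W : {set T} | (W \subset U) && shattered F W) #|W|.

End VCDimension.

(* 'Z_q is the ring of integers modulo q only when 1 < q. *)
Definition hamming_vertex (q : nat) : finType := ('Z_q * 'Z_q)%type.

Definition hamming_adj (q : nat) : rel (hamming_vertex q) :=
  fun x y => (x.1 != y.1) (+) (x.2 != y.2).

Definition neighborhood (q : nat) (x : hamming_vertex q) :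
  {set hamming_vertex q} := [set y | hamming_adj x y].

Definition neighborhoods (q : nat) (U : {set hamming_vertex q}) :
  {set {set hamming_vertex q}} := [set neighborhood u | u in U].

(* Main.v *)
Require Import Defs.
From mathcomp Require Import all_boot all_algebra.
From mathcomp Require Import zify.

(** View the points of U as edges between rows and columns. If some line holds
    three points of U and U has a point off that line, then two of the three
    points are shattered; so a set of VC-dimension less than 2 with more than q
    points has at most two points on each line, hence at most 2q points. If it
    has exactly 2q, then every line holds exactly two, and three corners of a
    rectangle force the fourth, as otherwise the two opposite corners would be
    shattered. The rows then partition the columns into pairs, so q is even.
    The extremal examples consist of disjoint 2 x 2 squares down the diagonal,
    plus a single point when q is odd. *)

Set Implicit Arguments.
Unset Strict Implicit.
Unset Printing Implicit Defensive.

(** * Criteria for VC-dimension two *)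

Section Shattering.

Variable T : finType.
Implicit Types (F : {set {set T}}) (U W : {set T}).

Lemma vc_dim_ge2 F U (x y : T) (N0 Nx Ny Nxy : {set T}) :
  x \in U -> y \in U -> x != y ->
  [/\ N0 \in F, x \notin N0 & y \notin N0] ->
  [/\ Nx \in F, x \in Nx & y \notin Nx] ->
  [/\ Ny \in F, x \notin Ny & y \in Ny] ->
  [/\ Nxy \in F, x \in Nxy & y \in Nxy] ->
  2 <= vc_dim U F.
Proof.
move=> xU yU xy [F0 x0 y0] [Fx xx yx] [Fy xy' yy] [Fxy xxy yxy].
have <- : #|[set x; y]| = 2 by rewrite cards2 xy.
apply: (@leq_bigmax_cond _ _ (fun W : {set T} => #|W|)).
apply/andP; split; first by apply/subsetP=> z /set2P[] ->.
apply/forallP=> S; apply/implyP=> /subsetP SW.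
have trace N : N \in F -> (x \in N) = (x \in S) -> (y \in N) = (y \in S) ->
    [exists N' in F, N' :&: [set x; y] == S].
  move=> NF Ex Ey; apply/existsP; exists N; rewrite NF /=.
  apply/eqP/setP=> z; rewrite inE.
  have [/set2P[]-> | zW] := boolP (z \in [set x; y]); rewrite ?andbT //.
  by rewrite andbF; apply/esym/negbTE; apply: contra zW => /SW.
case xS: (x \in S); case yS: (y \in S).
- by apply: (trace Nxy); rewrite // ?xS ?yS.
- by apply: (trace Nx); rewrite // ?xS ?yS // (negbTE yx).
- by apply: (trace Ny); rewrite // ?xS ?yS // (negbTE xy').
- by apply: (trace N0); rewrite // ?xS ?yS ?(negbTE x0) ?(negbTE y0).
Qed.

(** A shattered set with distinct points [x] and [y] would have both itself and [[set x]] as traces;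
    the hypothesis forces [y] into the second trace. *)
Lemma vc_dim_lt2 F U :
  (forall x y Nx Nxy, x \in U -> y \in U -> x != y ->
     Nxy \in F -> x \in Nxy -> y \in Nxy ->
     Nx \in F -> x \in Nx -> y \in Nx) ->
  vc_dim U F < 2.
Proof.
move=> noF; rewrite ltnS; apply/bigmax_leqP=> W /andP[/subsetP WU shW].
rewrite leqNgt; apply/negP=> /card_gt1P[x [y [xW yW xy]]].
have trace (S : {set T}) : S \subset W -> exists2 N, N \in F & N :&: W = S.
  by move=> SW; have /implyP/(_ SW)/exists_inP[N NF /eqP] := forallP shW S; exists N.
have [Nxy Fxy Exy] := trace W (subxx _).
have [|Nx Fx Ex] := trace [set x]; first by rewrite sub1set.
have xNx : x \in Nx by have := set11 x; rewrite -Ex inE => /andP[].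
have yNxy z : z \in W -> z \in Nxy by rewrite -{1}Exy inE => /andP[].
have yNx := noF x y Nx Nxy (WU _ xW) (WU _ yW) xy Fxy (yNxy _ xW) (yNxy _ yW) Fx xNx.
have : y \in Nx :&: W by rewrite inE yNx.
by rewrite Ex inE eq_sym (negbTE xy).
Qed.

End Shattering.

(** * Counting points on rows and columns *)

Section Lines.

Variable q : nat.
Implicit Types (U : {set hamming_vertex q}).

Lemma neighborhoods_vc_dim_ge2 U (x y u0 ux uy uxy : hamming_vertex q) :
  x \in U -> y \in U -> x != y ->
  [/\ u0 \in U, ~~ hamming_adj u0 x & ~~ hamming_adj u0 y] ->
  [/\ ux \in U, hamming_adj ux x & ~~ hamming_adj ux y] ->
  [/\ uy \in U, ~~ hamming_adj uy x & hamming_adj uy y] ->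
  [/\ uxy \in U, hamming_adj uxy x & hamming_adj uxy y] ->
  2 <= vc_dim U (neighborhoods U).
Proof.
move=> xU yU xy [? ? ?] [? ? ?] [? ? ?] [? ? ?].
apply: (vc_dim_ge2 (N0 := neighborhood u0) (Nx := neighborhood ux)
  (Ny := neighborhood uy) (Nxy := neighborhood uxy) xU yU xy);
  by split; rewrite ?imset_f // inE.
Qed.

Definition row_of U (i : 'Z_q) : {set 'Z_q} := [set j | (i, j) \in U].
Definition col_of U (j : 'Z_q) : {set 'Z_q} := [set i | (i, j) \in U].

Lemma sum_row_of U : \sum_i #|row_of U i| = #|U|.
Proof.
under eq_bigr do rewrite -sum1_card big_mkcond.
rewrite pair_bigA -sum1_card [RHS]big_mkcond /=.
by apply: eq_bigr => -[i j] _; rewrite inE.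
Qed.

Lemma sum_col_of U : \sum_j #|col_of U j| = #|U|.
Proof.
rewrite -sum_row_of.
under eq_bigr do rewrite -sum1_card big_mkcond.
under [RHS]eq_bigr do rewrite -sum1_card big_mkcond.
rewrite exchange_big /=; apply: eq_bigr => i _.
by apply: eq_bigr => j _; rewrite !inE.
Qed.

(** Rows and columns are treated at once: [p i] parametrizes the line of index [i], and [line i]
    holds the parameters of its points in [U]. *)
Lemma card_line_le2 (p : 'Z_q -> 'Z_q -> hamming_vertex q)
    (line : 'Z_q -> {set 'Z_q}) U a :
  1 < q ->
  (forall i j k l, hamming_adj (p i j) (p k l) = (i != k) (+) (j != l)) ->
  (forall i, injective (p i)) ->
  (forall i j, (j \in line i) = (p i j \in U)) ->
  \sum_i #|line i| = #|U| -> q < #|U| ->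
  vc_dim U (neighborhoods U) < 2 ->
  #|line a| <= 2.
Proof.
move=> q1 adjE pI lineE sum_line qU vc_lt2.
rewrite leqNgt; apply: contraL vc_lt2 => /card_gt2P[x [y [z [[xU yU zU] [xy yz zx]]]]].
rewrite -leqNgt; rewrite !lineE in xU yU zU.
have [c ca [d cdU]] : exists2 c, c != a & exists d, p c d \in U.
  have [c /andP[ca /set0Pn[d]] | none] := pickP [pred c | (c != a) && (line c != set0)].
    by rewrite lineE => cdU; exists c => //; exists d.
  (* If all other lines were empty, [U] would lie on line [a] and have at most [q] points. *)
  move: qU; rewrite -sum_line (bigD1 a) //= big1 ?addn0 => [|c ca].
    by rewrite ltnNge -[leqRHS](Zp_cast q1) -[leqRHS]card_ord max_card.
  by have := none c; rewrite /= ca /= => /negbFE/eqP->; rewrite cards0.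
(* The off-line point [p c d] sees neither point of the pair, each of the two sees only the other,
   and the third point [p a r] sees both. *)
have shattered_pair s t r : p a s \in U -> p a t \in U -> p a r \in U ->
    s != t -> r != s -> r != t -> d != s -> d != t ->
    2 <= vc_dim U (neighborhoods U).
  move=> sU tU rU st rs rt ds dt.
  apply: (neighborhoods_vc_dim_ge2 (x := p a s) (y := p a t) (u0 := p c d)
    (ux := p a t) (uy := p a s) (uxy := p a r)); rewrite ?adjE ?(inj_eq (@pI a)) //;
  by split; rewrite ?adjE ?eqxx ?ca ?ds ?dt ?rs ?rt // eq_sym st.
(* At most one of [x], [y], [z] equals [d]; such a point takes the role of [r]. *)
have [dx|dx] := eqVneq d x.
  by apply: (shattered_pair y z x); rewrite // ?dx // eq_sym.
have [dy|dy] := eqVneq d y.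
  by apply: (shattered_pair x z y); rewrite // ?dy // eq_sym.
by apply: (shattered_pair x y z); rewrite // eq_sym.
Qed.

Lemma card_row_le2 U i : 1 < q -> q < #|U| ->
  vc_dim U (neighborhoods U) < 2 -> #|row_of U i| <= 2.
Proof.
move=> q1; apply: (card_line_le2 (p := pair) (line := row_of U)) => //.
- by move=> j k l [].
- by move=> j k; rewrite inE.
- exact: sum_row_of.
Qed.

Lemma card_col_le2 U j : 1 < q -> q < #|U| ->
  vc_dim U (neighborhoods U) < 2 -> #|col_of U j| <= 2.
Proof.
move=> q1; apply: (card_line_le2 (p := fun a b => (b, a)) (line := col_of U)) => //.
- by move=> *; rewrite /hamming_adj addbC.
- by move=> i k l [].
- by move=> i k; rewrite inE.
- exact: sum_col_of.
Qed.

Lemma card_le_vc_dim_lt2 U : 1 < q ->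
  vc_dim U (neighborhoods U) < 2 -> #|U| <= 2 * q.
Proof.
move=> q1 vc_lt2; have [|qU] := leqP #|U| q; first by lia.
have -> : 2 * q = \sum_(i : 'Z_q) 2 by rewrite sum_nat_const card_ord Zp_cast // mulnC.
by rewrite -sum_row_of; apply: leq_sum => i _; apply: card_row_le2.
Qed.

(** * Sets with exactly two points on every line *)

Lemma sum_le2_eq2 (f : 'Z_q -> nat) : 1 < q ->
  (forall i, f i <= 2) -> 2 * q <= \sum_i f i -> forall i, f i = 2.
Proof.
move=> q1 f2 fsum i; apply/eqP; rewrite eqn_leq f2 /= leqNgt; apply/negP=> fi.
move: fsum; apply/negP; rewrite -ltnNge.
have -> : 2 * q = \sum_(i : 'Z_q) 2 by rewrite sum_nat_const card_ord Zp_cast // mulnC.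
rewrite (bigD1 i) //= [X in _ < X](bigD1 i) //= -addSn leq_add //.
by apply: leq_sum.
Qed.

Lemma rectangle_closed U i j k l :
  (forall i, #|row_of U i| = 2) -> (forall j, #|col_of U j| = 2) ->
  vc_dim U (neighborhoods U) < 2 ->
  (i, j) \in U -> (i, l) \in U -> (k, j) \in U -> (k, l) \in U.
Proof.
move=> row2 col2 vc_lt2 ijU ilU kjU; apply: contraLR vc_lt2 => klU.
have ki : k != i by apply: contraNneq klU => ->.
have lj : l != j by apply: contraNneq klU => ->.
have other (A : {set 'Z_q}) a : #|A| = 2 -> a \in A -> exists2 b, b \in A & b != a.
  move=> A2 aA; have : 0 < #|A :\ a| by have := cardsD1 a A; rewrite aA A2; lia.
  by case/card_gt0P=> b; rewrite !inE => /andP[ba bA]; exists b.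
(* The second points of column [l] and of row [k] each see one of the opposite corners [(i, l)] and
   [(k, j)]; they miss the other because neither is [(k, l)]. The corner [(i, j)] sees both, and
   [(i, l)] sees neither. *)
have [|m] := other _ i (col2 l); rewrite inE // => mlU mi.
have [|n] := other _ j (row2 k); rewrite inE // => knU nj.
have mk : m != k by apply: contraNneq klU => <-.
have nl : n != l by apply: contraNneq klU => <-.
rewrite -leqNgt; apply: (neighborhoods_vc_dim_ge2 (x := (i, l)) (y := (k, j))
  (u0 := (i, l)) (ux := (m, l)) (uy := (k, n)) (uxy := (i, j))) => //;
  rewrite ?xpair_eqE ?/(hamming_adj _ _) /= ?(eq_sym i k) ?(eq_sym j l);
  by rewrite ?eqxx ?(negbTE ki) ?(negbTE lj) ?(negbTE mi) ?(negbTE mk)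
    ?(negbTE nj) ?(negbTE nl).
Qed.

Lemma card_eq_vc_dim_lt2_even U : 1 < q ->
  2 * q <= #|U| -> vc_dim U (neighborhoods U) < 2 -> ~~ odd q.
Proof.
move=> q1 U2q vc_lt2; have qU : q < #|U| by lia.
have row2 : forall i, #|row_of U i| = 2.
  by apply: sum_le2_eq2; rewrite ?sum_row_of // => i; apply: card_row_le2.
have col2 : forall j, #|col_of U j| = 2.
  by apply: sum_le2_eq2; rewrite ?sum_col_of // => j; apply: card_col_le2.
have closed := rectangle_closed row2 col2 vc_lt2.
(* Rows with the same columns give one block of [P]. By [closed], rows that share a column coincide,
   so the blocks are disjoint pairs. *)
pose P := [set row_of U i | i in setT].
suff partP : partition P setT.
  have : #|[set: 'Z_q]| = #|P| * 2.
    by apply: (card_uniform_partition _ partP) => A /imsetP[i _ ->].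
  rewrite cardsT card_ord [in LHS]Zp_cast // => ->.
  by rewrite muln2 odd_double.
apply/and3P; split.
- rewrite eqEsubset subsetT /=; apply/subsetP=> j _.
  have /card_gt0P[i] : 0 < #|col_of U j| by rewrite col2.
  rewrite inE => ijU; apply/bigcupP; exists (row_of U i); first exact: imset_f.
  by rewrite inE.
- apply/trivIsetP=> A B /imsetP[i _ ->] /imsetP[k _ ->].
  apply: contraR => /pred0Pn[j /andP[]]; rewrite /= !inE => ijU kjU.
  apply/eqP/setP=> l; rewrite !inE.
  by apply/idP/idP=> lU; [apply: (closed i j) | apply: (closed k j)].
- by apply/imsetP=> -[i _ i0]; have := row2 i; rewrite -i0 cards0.
Qed.

(** * The extremal sets *)

Definition diagonal_blocks : {set hamming_vertex q} :=
  [set x : 'Z_q * 'Z_q | (x.1)./2 == (x.2)./2].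

(** Numbers with the same half are told apart by parity alone, so [!=] is the difference of parities
    and adds up modulo 2. *)
Lemma half_neq_addb m n p : m./2 = n./2 -> n./2 = p./2 ->
  (m != p) = (m != n) (+) (n != p).
Proof.
move=> mn np; case: (eqVneq m n) => [->|mn'] //=.
by case: (eqVneq n p) => [<-|np'] //=; apply/negbTE/negPn/eqP; lia.
Qed.

(** Adjacent points share a coordinate, and either coordinate of a point of [diagonal_blocks]
    determines its block. *)
Lemma diagonal_blocks_adj (x y : hamming_vertex q) :
  x \in diagonal_blocks -> y \in diagonal_blocks -> hamming_adj x y ->
  x.1./2 = y.1./2 /\ x.2./2 = y.2./2.
Proof.
case: x y => [x1 x2] [y1 y2]; rewrite !inE /hamming_adj /= => /eqP xB /eqP yB.
case: (eqVneq x1 y1) => [x1y1|_]; case: (eqVneq x2 y2) => [x2y2|_] // _.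
- by rewrite -xB -yB x1y1.
- by rewrite xB yB x2y2.
Qed.

(* Inside a block adjacency is complete bipartite, so the points that share a
   neighbor all have the same neighborhood. *)
Lemma diagonal_blocks_vc_dim :
  vc_dim diagonal_blocks (neighborhoods diagonal_blocks) < 2.
Proof.
apply: vc_dim_lt2 => x y Nx Nxy xB yB _ /imsetP[u uB ->] + + /imsetP[v vB ->].
rewrite !inE => ux uy vx.
have [ux1 ux2] := diagonal_blocks_adj uB xB ux.
have [uy1 uy2] := diagonal_blocks_adj uB yB uy.
have [vx1 vx2] := diagonal_blocks_adj vB xB vx.
have adj_addb (a b c : hamming_vertex q) :
    a.1./2 = b.1./2 -> b.1./2 = c.1./2 -> a.2./2 = b.2./2 -> b.2./2 = c.2./2 ->
    hamming_adj a c = hamming_adj a b (+) hamming_adj b c.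
  move=> ab1 bc1 ab2 bc2; rewrite /hamming_adj -!val_eqE /=.
  by rewrite (half_neq_addb ab1 bc1) (half_neq_addb ab2 bc2) addbACA.
have xy : hamming_adj x y = false.
  have := adj_addb u x y; rewrite ux uy -ux1 -ux2 => /(_ erefl uy1 erefl uy2).
  by case: (hamming_adj x y).
by rewrite (adj_addb v x y) ?vx ?xy // -?ux1 -?ux2.
Qed.

Lemma card_diagonal_blocks : 1 < q -> #|diagonal_blocks| = 2 * q - odd q.
Proof.
move=> q1; rewrite -sum_row_of.
(* Only [m.*2] and its successor have half [m]; the truncated subtraction gives 0 when both lie
   beyond the range. *)
have sum_half m n : \sum_(0 <= j < n) (m == j./2) = minn (n - m.*2) 2.
  elim: n => [|n IHn]; first by rewrite big_geq // min0n.
  by rewrite big_nat_recr //= IHn; lia.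
(* Passing from [n] to [n.+1] adds a row and a column: one new point if [n] is even, where a block
   starts, and three if it is odd. *)
have sum_halves n : \sum_(0 <= i < n) \sum_(0 <= j < n) (i./2 == j./2) = 2 * n - odd n.
  elim: n => [|n IHn]; first by rewrite big_geq.
  rewrite big_nat_recr //= sum_half.
  under eq_bigr do rewrite big_nat_recr //= eq_sym.
  by rewrite big_split /= IHn sum_half; lia.
rewrite -(sum_halves q) -[in RHS](Zp_cast q1) big_mkord; apply: eq_bigr => i _.
rewrite big_mkord -sum1_card big_mkcond /=; apply: eq_bigr => j _.
by rewrite !inE /=; case: eqP.
Qed.

End Lines.

Theorem theorem1p2 :
  (* (i) *)
  (forall q : nat, 3 <= q -> odd q ->
     forall U : {set hamming_vertex q}, 2 * q <= #|U| ->
       2 <= vc_dim U (neighborhoods U)) /\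
  (* (ii) *)
  (forall q : nat, 3 <= q -> odd q ->
     exists U : {set hamming_vertex q},
       #|U| = 2 * q - 1 /\ vc_dim U (neighborhoods U) < 2) /\
  (* (iii) the general bound, and its tightness for even q *)
  (forall q : nat, 3 <= q ->
     forall U : {set hamming_vertex q}, 2 * q + 1 <= #|U| ->
       2 <= vc_dim U (neighborhoods U)) /\
  (forall q : nat, 4 <= q -> ~~ odd q ->
     exists U : {set hamming_vertex q},
       #|U| = 2 * q /\ vc_dim U (neighborhoods U) < 2).
Proof.
split=> [q q3 oddq U cardU|].
  rewrite leqNgt; apply/negP=> /(card_eq_vc_dim_lt2_even (ltnW q3) cardU).
  by rewrite oddq.
split=> [q q3 oddq|].
  exists (diagonal_blocks q); split; last exact: diagonal_blocks_vc_dim.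
  by rewrite card_diagonal_blocks ?oddq //; lia.
split=> [q q3 U cardU|q q4 evenq].
  rewrite leqNgt; apply/negP=> /(card_le_vc_dim_lt2 (ltnW q3)).
  by lia.
exists (diagonal_blocks q); split; last exact: diagonal_blocks_vc_dim.
by rewrite card_diagonal_blocks ?(negbTE evenq) ?subn0 //; lia.
Qed.
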